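(* Let $k^*\in(0,1)$ and, for each $N\ge 1$, let $T^*=[k^*N]$. Let $\{X_t\}_{t\in\mathbb{Z}}$ be a strictly stationary and ergodic sequence of $d$-dimensional random vectors with $\mathbb{E}[X_0]=0$ and $\mathbb{E}[\|X_0\|^2]<\infty$, and let $\{X_t^*\}_{t\in\mathbb{Z}}$ be another strictly stationary and ergodic sequence of $d$-dimensional random vectors (on the same probability space) with $\mathbb{E}[X_0^*]\ne\mathbb{E}[X_0]$ and $\mathbb{E}[\|X_0^*\|^2]<\infty$. For each $N$ define $Y_t=X_t$ for $t\le T^*$ and $Y_t=X_t^*$ for $T^*<t\le N$, so that $T^*$ is the change-point in the mean of the data $Y_1,\ldots,Y_N$. Put $$\tilde S_N(t)=\frac{1}{\sqrt N}\left(\sum_{i=1}^{[Nt]}Y_i-t\sum_{i=1}^{N}Y_i\right),\qquad t\in[0,1].$$ Let $\hat\Sigma_N$ be a sequence of random $d\times d$ matrices with $\hat\Sigma_N\to\Sigma$ in probability, where $\Sigma=\sum_{j\in\mathbb{Z}}\mathrm{Cov}(X_0,X_j)$ is (absolutely convergent and) positive definite. Then both $$\operatorname*{arg\,max}_{t\in[0,1]}\left\|\tilde S_N(t)\right\|\qquad\text{and}\qquad \operatorname*{arg\,max}_{t\in[0,1]}\frac1N\,\tilde S_N(t)^{T}\,\hat\Sigma_N^{-1}\,\tilde S_N(t)$$ are consistent estimators of $k^*$, i.e. they converge to $k^*$ in probability as $N\to\infty$.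
   Context: $[x]$ is the integer part of $x$ and $\|\cdot\|$ is the Euclidean norm on $\mathbb{R}^d$. The matrix $\hat\Sigma_N$ is invertible with probability tending to $1$, since its limit in probability is positive definite; on the exceptional event the second estimator may be defined arbitrarily in $[0,1]$. For a càdlàg function $F$ on $[0,1]$, $\operatorname{arg\,max}_{t\in[0,1]}F(t)$ denotes any (measurably chosen) point $\tau\in[0,1]$ at which the supremum of $F$ is attained, either as the value $F(\tau)$ or as the left limit $F(\tau-)$. *)

(* Defs.v *)
From HB Require Import structures.
From mathcomp Require Import all_boot all_order all_algebra.
From mathcomp Require Import all_classical all_reals all_analysis.

Set Implicit Arguments.
Unset Strict Implicit.
Unset Printing Implicit Defensive.

Import Order.TTheory GRing.Theory Num.Theory.
Import numFieldNormedType.Exports.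

Local Open Scope classical_set_scope.
Local Open Scope ring_scope.

Section linear_algebra.
Context {R : realType} {d : nat}.

(* The library norm `|x| on 'cV[R]_d is the maximum norm, not this one. *)
Definition enorm (x : 'cV[R]_d) : R := Num.sqrt (\sum_(i < d) x i ord0 ^+ 2).

Definition quadform (A : 'M[R]_d) (x : 'cV[R]_d) : R :=
  (x^T *m A *m x) ord0 ord0.

Definition posdefmx (A : 'M[R]_d) : Prop :=
  A^T = A /\ forall x : 'cV[R]_d, x != 0 -> 0 < quadform A x.

End linear_algebra.

Section path_space.
Context {R : realType} {d : nat}.

(* The product Borel sigma-algebra on (R^d)^Z, generated by the events that
   constrain one coordinate of the vector at one time. *)
Definition measurable_path : set (set (int -> 'cV[R]_d)) :=
  <<s [set A | exists (t : int) (i : 'I_d) (B : set R),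
         measurable B /\ A = [set x : int -> 'cV[R]_d | B (x t i ord0)]] >>.

Definition shift_path (h : int) (x : int -> 'cV[R]_d) : int -> 'cV[R]_d :=
  fun t => x (t + h).

End path_space.

Section random_sequences.
Context {disp : measure_display} {T : measurableType disp} {R : realType}.
Variable P : probability T R.

Definition random_mx {m n : nat} (A : T -> 'M[R]_(m, n)) : Prop :=
  forall i j, measurable_fun [set: T] (fun w => A w i j).

(* For matrices, `| _ | is the maximum of the absolute values of the entries. *)
Definition cvg_in_probability {V : normedModType R} (U : nat -> T -> V) (u : V)
    : Prop :=
  forall eps : R, 0 < eps ->
    P [set w | eps < `|U n w - u|] @[n --> \oo] --> 0%E.

Context {d : nat}.
Implicit Types X : int -> T -> 'cV[R]_d.

(* [fine] is harmless when the components are integrable. *)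
Definition mean_vec (x : T -> 'cV[R]_d) : 'cV[R]_d :=
  \col_(i < d) fine ('E_P[fun w => x w i ord0])%E.

Definition strictly_stationary X : Prop :=
  forall (h : int) (A : set (int -> 'cV[R]_d)), measurable_path A ->
    P [set w | A (shift_path h (X ^~ w))] = P [set w | A (X ^~ w)].

Definition ergodic X : Prop :=
  forall A : set (int -> 'cV[R]_d), measurable_path A ->
    shift_path 1 @^-1` A = A ->
    P [set w | A (X ^~ w)] = 0%E \/ P [set w | A (X ^~ w)] = 1%E.

Definition crosscov X (j : int) (a b : 'I_d) : \bar R :=
  covariance P (fun w => X 0 w a ord0) (fun w => X j w b ord0).

(* [Sigma] is the sum over j in Z of Cov(X_0, X_j), the series being absolutely
   convergent; the sum is then the limit of the sums over -n <= j <= n. *)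
Definition is_longrun_cov X (Sigma : 'M[R]_d) : Prop :=
  (forall a b, summable [set: int] (fun j => crosscov X j a b)) /\
  (\sum_(i < n.*2.+1)
     \matrix_(a < d, b < d) fine (crosscov X (i%:Z - n%:Z) a b))
    @[n --> \oo] --> Sigma.

End random_sequences.

Section change_point.
Context {disp : measure_display} {T : measurableType disp} {R : realType}.
Context {d : nat}.

Definition change_at (Tstar : nat) (X Xs : int -> T -> 'cV[R]_d)
    : int -> T -> 'cV[R]_d :=
  fun t => if t <= Tstar%:Z then X t else Xs t.

Definition cusum (Y : int -> T -> 'cV[R]_d) (N : nat) (w : T) (t : R)
    : 'cV[R]_d :=
  (Num.sqrt N%:R)^-1 *:
    (\sum_(1 <= i < (Num.truncn (N%:R * t)).+1) Y i%:Z w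
     - t *: \sum_(1 <= i < N.+1) Y i%:Z w).

(* The points of [0, 1] where the supremum over [0, 1] is attained, as a value
   or as a left limit. *)
Definition argmax01 (F : R -> R) : set R :=
  [set tau | 0 <= tau <= 1 /\
    (supremums (F @` `[0, 1]) (F tau) \/
     0 < tau /\ exists l : R,
       F s @[s --> tau^'-] --> l /\ supremums (F @` `[0, 1]) l)].

End change_point.

(* Main.v *)
Require Import Defs.
From HB Require Import structures.
From mathcomp Require Import all_boot all_order all_algebra.
From mathcomp Require Import all_classical all_reals all_analysis.
From mathcomp Require Import measurable_realfun ring lra.

Import Order.TTheory GRing.Theory Num.Theory.
Import numFieldNormedType.Exports.
Local Open Scope classical_set_scope.
Local Open Scope ring_scope.

Set Implicit Arguments.
Unset Strict Implicit.
Unset Printing Implicit Defensive.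

(** Why the theorem holds.  Write [v] for the mean of [Xs 0], which is nonzero
because it differs from the mean of [X 0].  Divided by [Num.sqrt N%:R], the CUSUM
process is close, uniformly in [t] and with probability tending to one, to [- tent k t *: v] with [tent k t = min t k - t * k]: the
partial sums of [Y] only deviate from their piecewise linear means by the
fluctuations of the partial sums of [X] and of [Xs].  The tent has a sharp peak
at [k], so whatever point maximises a process that is uniformly close to
[tent k t ^+ 2 * q], with [q > 0], must be close to [k].  Both estimators are of
this kind: the squared Euclidean norm is the quadratic form of the identity
matrix, and on an event of probability tending to one the inverse of
[Sigmahat N] is close to the positive definite matrix [invmx Sigma].

The probabilistic content is therefore a law of large numbers that is uniform
over the partial sums ([uniform_weak_lln]).  It comes from Birkhoff's argument
in the ergodic case ([birkhoff_sum_tail]): if [f] has negative mean then the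
sums of [f] along orbits are almost surely bounded above, because the event
where they are unbounded is invariant, hence has probability 0 or 1, and [f]
has a nonnegative integral over it ([integral_unbounded_sums_ge0]).  Applied
to [f] and to [- f], both recentred by a small constant, boundedness gives
a linear bound [delta * N] simultaneously for all partial sums of length at
most [N], outside an event whose probability vanishes;
[stationary_sum_tail] transports the statement from the shift on path space to
the given process.

The rest is deterministic: [cusum_tent] (CUSUM against tent), [quadform_perturb]
and [invmx_perturb] (stability of the quadratic form and of the inverse),
[argmax01_tent] (a near-maximiser of the tent is near the peak).  They are
assembled in [argmax_quadform_consistent], which covers both estimators. *)

(** * Sequences of events of vanishing probability *)

Section negligible_events.
Context {disp : measure_display} {T : measurableType disp} {R : realType}.
Variable P : probability T R.

(** The events of interest are often suprema over uncountably many times, or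
negations of such; passing to measurable supersets removes every measurability
obligation until the very end. *)
Definition asymp_negligible (E : nat -> set T) : Prop :=
  exists B : nat -> set T, [/\ forall N, measurable (B N),
    \forall N \near \oo, E N `<=` B N & P (B N) @[N --> \oo] --> 0%E].

Lemma asymp_negligible_sub (E F : nat -> set T) :
  (\forall N \near \oo, E N `<=` F N) ->
  asymp_negligible F -> asymp_negligible E.
Proof.
move=> EF [B [mB FB PB0]]; exists B; split => //.
by near=> N; apply: (@subset_trans _ (F N)); near: N.
Unshelve. all: by end_near. Qed.

Lemma asymp_negligibleU (E F : nat -> set T) :
  asymp_negligible E -> asymp_negligible F ->
  asymp_negligible (fun N => E N `|` F N).
Proof.
move=> [B [mB EB PB]] [C [mC FC PC]]; exists (fun N => B N `|` C N); split.
- by move=> N; exact: measurableU.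
- by near=> N; apply: setUSS; near: N.
- apply: (@squeeze_cvge _ _ _ _ (cst 0%E) _ (fun N => P (B N) + P (C N))%E).
  + by near=> N; rewrite measure_ge0 /=; exact: measureU2.
  + exact: cvg_cst.
  + by rewrite -[X in _ --> X](adde0 0%E); apply: cvgeD.
Unshelve. all: by end_near. Qed.

Lemma asymp_negligible_bigcup (I : finType) (E : I -> nat -> set T) :
  (forall i, asymp_negligible (E i)) ->
  asymp_negligible (fun N => [set w | exists i, E i N w]).
Proof.
move=> negE.
suff H (s : seq I) :
    asymp_negligible (fun N => [set w | exists2 i, i \in s & E i N w]).
  apply: asymp_negligible_sub (H (index_enum I)).
  by apply: nearW => N w [i Ei]; exists i => //; rewrite mem_index_enum.
elim: s => [|i s IH].
  exists (fun=> set0); split => //; first by apply: nearW => N w [].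
  by under eq_fun do rewrite measure0; exact: cvg_cst.
apply: asymp_negligible_sub (asymp_negligibleU (negE i) IH).
apply: nearW => N w [j]; rewrite inE => /orP[/eqP ->|js] Ej; first by left.
by right; exists j.
Qed.

Lemma asymp_negligible_cvg0 (E : nat -> set T) :
  (forall N, measurable (E N)) -> asymp_negligible E ->
  P (E N) @[N --> \oo] --> 0%E.
Proof.
move=> mE [B [mB EB PB]].
apply: (@squeeze_cvge _ _ _ _ (cst 0%E) _ (P \o B)) => //; last exact: cvg_cst.
near=> N; rewrite measure_ge0 /= le_measure ?inE //; near: N; exact: EB.
Unshelve. all: by end_near. Qed.

End negligible_events.

(** * Birkhoff's argument for an ergodic transformation *)

Section birkhoff_sums.
Context {disp : measure_display} {T : measurableType disp} {R : realType}.
Variables (theta : T -> T) (f : T -> R).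

Definition birkhoff_sum (n : nat) (w : T) : R :=
  \sum_(i < n) f (iter i theta w).

(** The maximum of the Birkhoff sums of length at most [n], the empty one
included.  The recursive form is exactly the identity on which the ergodic
argument rests. *)
Fixpoint max_sum (n : nat) (w : T) : R :=
  if n is m.+1 then Num.max 0 (f w + max_sum m (theta w)) else 0.

Lemma birkhoff_sumS n w :
  birkhoff_sum n.+1 w = f w + birkhoff_sum n (theta w).
Proof.
rewrite /birkhoff_sum big_ord_recl; congr (_ + _).
by apply: eq_bigr => i _; rewrite lift0 iterSr.
Qed.

Lemma max_sum_ge0 n w : 0 <= max_sum n w.
Proof. by case: n => //= n; rewrite le_max lexx. Qed.

Lemma max_sum_nondecreasing w : nondecreasing_seq (max_sum ^~ w).
Proof.
apply/nondecreasing_seqP => n; elim: n w => [|n IH] w; first exact: max_sum_ge0.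
by rewrite /= ge_max !le_max lexx /= lerD2l IH orbT.
Qed.

Lemma birkhoff_sum_le_max n w : birkhoff_sum n w <= max_sum n w.
Proof.
elim: n w => [|n IH] w; first by rewrite /birkhoff_sum big_ord0.
by rewrite birkhoff_sumS /= le_max lerD2l IH orbT.
Qed.

Definition unbounded_sums : set T :=
  [set w | forall C : nat, exists n, C%:R < max_sum n w].

(** Passing from [w] to [theta w] changes the sums by the single term [f w],
which cannot create or destroy unboundedness. *)
Lemma unbounded_sums_invariant :
  theta @^-1` unbounded_sums = unbounded_sums.
Proof.
apply/seteqP; split => w /= wU C.
- have [n Cn] := wU (Num.truncn (C%:R - f w)).+1.
  exists n.+1; rewrite /= lt_max; apply/orP; right.
  have := truncnS_gt (C%:R - f w); lra.
- have [n Cn] := wU (Num.truncn (C%:R + `|f w|)).+1.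
  have C0 : 0 <= C%:R :> R by [].
  have Cfw : C%:R + `|f w| < max_sum n.+1 w.
    apply: lt_le_trans (max_sum_nondecreasing w (leqnSn n)).
    exact: lt_trans (truncnS_gt _) Cn.
  exists n; move: Cfw; rewrite /= lt_max => /orP[|].
    by have := normr_ge0 (f w); lra.
  by have := ler_norm (f w); lra.
Qed.

Hypotheses (mtheta : measurable_fun setT theta) (mf : measurable_fun setT f).

Lemma measurable_max_sum n : measurable_fun setT (max_sum n).
Proof.
elim: n => [|n IH]; first exact: measurable_cst.
apply: measurable_maxr; first exact: measurable_cst.
by apply: measurable_funD => //; exact: measurableT_comp.
Qed.

Lemma measurable_birkhoff_sum n : measurable_fun setT (birkhoff_sum n).
Proof.
have miter m : measurable_fun setT (fun w => iter m theta w).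
  elim: m => [|m IH]; first exact: measurable_id.
  exact: (measurableT_comp mtheta IH).
by apply: measurable_sum => i; exact: (measurableT_comp mf (miter i)).
Qed.

Lemma measurable_unbounded_sums : measurable unbounded_sums.
Proof.
have -> : unbounded_sums = \bigcap_C \bigcup_n [set w | C%:R < max_sum n w].
  apply/seteqP; split => w /=.
    by move=> wU C _; have [n ?] := wU C; exists n.
  by move=> wU C; have [n _ ?] := wU C I; exists n.
apply: bigcapT_measurable => C; apply: bigcupT_measurable => n.
rewrite -[X in measurable X]setTI.
apply: (@measurable_fun_ltr _ _ _ setT (cst C%:R)) => //.
exact: measurable_max_sum.
Qed.

End birkhoff_sums.

Section maximal_ergodic.
Context {disp : measure_display} {T : measurableType disp} {R : realType}.
Variables (P : probability T R) (theta : T -> T).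
Hypothesis mtheta : measurable_fun setT theta.
Hypothesis theta_preserves :
  forall A, measurable A -> P (theta @^-1` A) = P A.
Hypothesis theta_ergodic :
  forall A, measurable A -> theta @^-1` A = A -> P A = 0%E \/ P A = 1%E.

(** Over an invariant set, composing with a measure-preserving map does not
change the integral, since the preimage of the set is the set itself. *)
Lemma ge0_integral_comp_preserving (A : set T) (g : T -> \bar R) :
  measurable A -> theta @^-1` A = A -> measurable_fun setT g ->
  (forall w, 0 <= g w)%E ->
  (\int[P]_(w in A) g (theta w) = \int[P]_(w in A) g w)%E.
Proof.
move=> mA invA mg g0.
rewrite -[in LHS]invA -(@ge0_integral_pushforward _ _ _ _ _ _ mtheta P A g) //.
- by apply: eq_measure_integral => B mB _; exact: theta_preserves.
- exact: measurable_funTS.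
Qed.

Variable f : T -> R.
Hypothesis intf : P.-integrable setT (EFin \o f).

Let mf : measurable_fun setT f.
Proof. by apply/measurable_EFinP; case/integrableP: intf. Qed.

Local Notation M := (max_sum theta f).
Local Notation U := (unbounded_sums theta f).
Let mU : measurable U.
Proof. exact: measurable_unbounded_sums. Qed.
Let mM n : measurable_fun setT (M n).
Proof. exact: measurable_max_sum. Qed.

Lemma integrable_max_sum n : P.-integrable setT (EFin \o M n).
Proof.
elim: n => [|n IH].
  exact: (finite_measure_integrable_cst P 0).
have mMt : measurable_fun setT (M n \o theta) by exact: measurableT_comp.
have intMt : P.-integrable setT (EFin \o (M n \o theta)).
  apply/integrableP; split; first exact/measurable_EFinP.
  have/integrableP[_] := IH.
  rewrite -(@ge0_integral_comp_preserving setT) //.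
  by apply: measurableT_comp => //; exact/measurable_EFinP.
have intg : P.-integrable setT (EFin \o (fun w => `|f w| + M n (theta w))).
  exact: (integrableD measurableT (integrable_abse intf) intMt).
apply: le_integrable intg => //; first exact/measurable_EFinP.
move=> w _; rewrite /= lee_fin.
have m0 := max_sum_ge0 theta f n (theta w).
rewrite [leRHS]ger0_norm ?addr_ge0 // ger0_norm; last by rewrite le_max lexx.
by rewrite ge_max addr_ge0 //= lerD2r ler_norm.
Qed.

(** Where the maxima are unbounded, the maximum with 0 in the recursion is
eventually inactive, and what remains of the increment is [f w]. *)
Lemma max_sum_gain_cvg w : U w ->
  (M n.+1 w - M n (theta w))%:E @[n --> \oo] --> (f w)%:E.
Proof.
move=> Uw; apply: cvg_near_cst.
have [n0 Cn0] : exists n0, - f w < M n0 (theta w).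
  have : (theta @^-1` U) w by rewrite unbounded_sums_invariant.
  move=> /(_ (Num.truncn `|f w|).+1)[n0 Cn0]; exists n0.
  have := ler_norm (- f w); rewrite normrN => /le_lt_trans; apply.
  exact: lt_trans (truncnS_gt _) Cn0.
near=> n; congr (_%:E); rewrite /= max_r ?addrK //.
have : M n0 (theta w) <= M n (theta w).
  by apply: max_sum_nondecreasing; near: n; exact: nbhs_infty_ge.
by lra.
Unshelve. all: by end_near. Qed.

Lemma max_sum_gain_le w n : `|M n.+1 w - M n (theta w)| <= `|f w|.
Proof.
have := max_sum_ge0 theta f n (theta w); rewrite /=.
set m := M n (theta w) => m0.
have [a1 a2] := (ler_norm (f w), ler_norm (- f w)); rewrite normrN in a2.
by case: (leP 0 (f w + m)) => fm; rewrite ler_norml; lra.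
Qed.

(** The integral over [U] of [M n.+1 - M n \o theta] equals that of
[M n.+1 - M n], which is nonnegative by monotonicity; by [max_sum_gain_cvg] and
dominated convergence these integrals tend to the integral of [f]. *)
Lemma integral_unbounded_sums_ge0 : (0 <= \int[P]_(w in U) (f w)%:E)%E.
Proof.
have intfU : P.-integrable U (EFin \o f) by exact: integrableS intf.
have mMt n : measurable_fun setT (M n \o theta) by exact: measurableT_comp.
have [] := @dominated_convergence _ _ _ P U mU
  (fun n w => (M n.+1 w - M n (theta w))%:E) (EFin \o f)
  (fun w => `|f w|%:E).
- move=> n; apply: measurable_funTS; apply/measurable_EFinP.
  exact: (measurable_funB (mM n.+1) (mMt n)).
- exact/measurable_EFinP/measurable_funTS.
- by apply: aeW => w /= ; exact: max_sum_gain_cvg.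
- exact: integrable_abse intfU.
- by apply: aeW => w n _; rewrite lee_fin max_sum_gain_le.
move=> _ _; apply: cvge_ge; apply: nearW => n /=.
have intMU k : P.-integrable U (EFin \o M k).
  exact: integrableS (integrable_max_sum k).
have intMt : P.-integrable U (EFin \o (M n \o theta)).
  apply/integrableP; split; first exact/measurable_EFinP/measurable_funTS.
  have/integrableP[_] := intMU n.
  rewrite -(@ge0_integral_comp_preserving U) //.
  - exact: unbounded_sums_invariant.
  - by apply: measurableT_comp => //; exact/measurable_EFinP.
under eq_integral do rewrite EFinB.
rewrite (integralB_EFin mU (intMU n.+1) intMt).
rewrite (@ge0_integral_comp_preserving U (EFin \o M n)) //.
- rewrite sube_ge0; last first.
    by apply/orP; left; apply: integrable_fin_num => //; exact: intMU.
  apply: (le_integral mU (intMU n) (intMU n.+1)) => w _; rewrite lee_fin.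
  exact: (max_sum_nondecreasing _ _ _ (leqnSn n)).
- exact: unbounded_sums_invariant.
- exact/measurable_EFinP.
- by move=> w; rewrite lee_fin max_sum_ge0.
Qed.

Lemma probability_unbounded_sums :
  (\int[P]_w (f w)%:E < 0)%E -> P U = 0%E.
Proof.
move=> f_lt0; have [//|PU1] := theta_ergodic mU (unbounded_sums_invariant _ _).
suff : (0 <= \int[P]_w (f w)%:E)%E by rewrite leNgt f_lt0.
have := integral_unbounded_sums_ge0.
have PUC : P (~` U) = 0%E by rewrite probability_setC // PU1 subee.
rewrite (negligible_integral (measurableC mU) measurableT intf PUC).
by rewrite setTD setCK.
Qed.

(** A random variable that is almost surely finite, here the supremum of all
Birkhoff sums, exceeds [N] with vanishing probability. *)
Lemma birkhoff_sum_tail : (\int[P]_w (f w)%:E < 0)%E ->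
  asymp_negligible P
    (fun N => [set w | exists n, N%:R < birkhoff_sum theta f n w]).
Proof.
move=> f_lt0.
pose B N := [set w | exists n, N%:R < M n w].
have mB N : measurable (B N).
  have -> : B N = \bigcup_n [set w | N%:R < M n w].
    by apply/seteqP; split => w /= [n]; [exists n|move=> _; exists n].
  apply: bigcupT_measurable => n; rewrite -[X in measurable X]setTI.
  exact: (@measurable_fun_ltr _ _ _ setT (cst N%:R)).
have BU : \bigcap_N B N = U.
  by apply/seteqP; split => w /= wB N; [exact: (wB N I)|move=> _; exact: wB].
exists B; split => //.
- apply: nearW => N w [n Nn]; exists n.
  exact: lt_le_trans Nn (birkhoff_sum_le_max _ _ _ _).
- rewrite -(probability_unbounded_sums f_lt0) -BU.
  apply: (@nonincreasing_cvg_mu _ _ _ P B) => //.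
  + by rewrite (le_lt_trans (probability_le1 _ _)) ?ltry.
  + by rewrite BU.
  + move=> N1 N2 N12; apply/subsetPset => w [n Nn]; exists n.
    by apply: le_lt_trans Nn; rewrite ler_nat.
Qed.

End maximal_ergodic.

(** * The maximum norm on matrices *)

Section matrix_max_norm.
Context {R : realType}.

Lemma mx_norm_entry {m n : nat} (A : 'M[R]_(m, n)) i j : `|A i j| <= `|A|.
Proof.
rewrite [leRHS]/Num.norm /= mx_normrE.
exact: (le_bigmax _ (fun ij => `|A ij.1 ij.2|) (i, j)).
Qed.

Lemma mx_norm_le {m n : nat} (A : 'M[R]_(m, n)) (c : R) : 0 <= c ->
  (forall i j, `|A i j| <= c) -> `|A| <= c.
Proof.
move=> c0 Ac; rewrite [leLHS]/Num.norm /= mx_normrE.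
by apply: bigmax_le => // -[i j] _; exact: Ac.
Qed.

Lemma mx_norm_gt {m n : nat} (A : 'M[R]_(m, n)) (c : R) : 0 <= c ->
  c < `|A| -> exists ij, c < `|A ij.1 ij.2|.
Proof.
move=> c0; rewrite [X in _ < X]/Num.norm /= mx_normrE => /bigmax_gtP[|[ij _ ?]].
  by rewrite ltNge c0.
by exists ij.
Qed.

Lemma mx_norm_mul {m n p : nat} (A : 'M[R]_(m, n)) (B : 'M[R]_(n, p)) :
  `|A *m B| <= n%:R * `|A| * `|B|.
Proof.
apply: mx_norm_le => [|i j]; first by rewrite !mulr_ge0.
rewrite mxE (le_trans (ler_norm_sum _ _ _)) // -mulrA.
rewrite mulr_natl -[X in _ *+ X](card_ord n) -sumr_const.
by apply: ler_sum => k _; rewrite normrM ler_pM // mx_norm_entry.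
Qed.

End matrix_max_norm.

Lemma measurable_mx_norm_gt {disp : measure_display} {T : measurableType disp}
    {R : realType} {m n : nat} (A : T -> 'M[R]_(m, n)) B (c : R) :
  random_mx A -> 0 <= c -> measurable [set w | c < `|A w - B|].
Proof.
move=> mA c0.
have -> : [set w | c < `|A w - B|] =
    \bigcup_(ij in [set: 'I_m * 'I_n])
      [set w | c < `|A w ij.1 ij.2 - B ij.1 ij.2|].
  apply/seteqP; split => w /=.
    by move=> /(mx_norm_gt c0)[ij]; rewrite !mxE; exists ij.
  move=> [ij _] /= /lt_le_trans; apply.
  by have := mx_norm_entry (A w - B) ij.1 ij.2; rewrite !mxE.
apply: fin_bigcup_measurable => // ij _; rewrite -[X in measurable X]setTI.
apply: (@measurable_fun_ltr _ _ _ setT (cst c)) => //.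
apply: measurableT_comp => //; exact: measurable_funB.
Qed.

(** * A uniform law of large numbers for stationary ergodic processes *)

Section path_law.
Context {disp : measure_display} {T : measurableType disp} {R : realType}.
Context {d : nat}.

Definition coordinate_events : set (set (int -> 'cV[R]_d)) :=
  [set A | exists (t : int) (i : 'I_d) (B : set R),
     measurable B /\ A = [set x : int -> 'cV[R]_d | B (x t i ord0)]].

Local Notation pathT := (g_sigma_algebraType coordinate_events).

Lemma measurable_coordinate (t : int) (i : 'I_d) :
  measurable_fun setT (fun x : pathT => x t i ord0).
Proof.
move=> _ B mB; rewrite setTI; apply: sub_sigma_algebra.
by exists t, i, B.
Qed.

Lemma measurable_to_path {disp' : measure_display} {U : measurableType disp'}
    (F : U -> pathT) :
  (forall t i, measurable_fun setT (fun u => F u t i ord0)) ->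
  measurable_fun setT F.
Proof.
move=> mF; apply: (@measurability _ _ _ _ setT F coordinate_events) => //.
move=> _ [_ [t [i [B [mB ->]]]] <-].
exact: (mF t i measurableT B mB).
Qed.

Lemma measurable_shift_path (h : int) :
  measurable_fun setT (shift_path h : pathT -> pathT).
Proof. by apply: measurable_to_path => t i; exact: measurable_coordinate. Qed.

Lemma iter_shift_path (n : nat) (x : int -> 'cV[R]_d) (t : int) :
  iter n (shift_path 1) x t = x (t + n%:Z).
Proof.
elim: n t => [|n IH] t; first by rewrite addr0.
by rewrite iterS {1}/shift_path IH -addrA -intS.
Qed.

Variables (P : probability T R) (X : int -> T -> 'cV[R]_d).
Hypothesis X_rv : forall t, random_mx (X t).

Let path : T -> pathT := fun w => X ^~ w.
Let mpath : measurable_fun setT path.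
Proof. by apply: measurable_to_path => t i; exact: X_rv. Qed.
HB.instance Definition _ := isMeasurableFun.Build _ _ _ _ path mpath.

(** Under the law of the process on path space the shift preserves the measure
and is ergodic, so [birkhoff_sum_tail] applies to a function of the coordinate
at time 0.  Its orbit sums run over the times 0, ..., n - 1; stationarity is used
once more to move them to 1, ..., n. *)
Lemma stationary_sum_tail (i : 'I_d) (a b : R) :
  strictly_stationary P X -> ergodic P X ->
  P.-integrable setT (fun w => (X 0 w i ord0)%:E) ->
  a * mean_vec P (X 0) i ord0 < b ->
  asymp_negligible P (fun N => [set w | exists n,
    N%:R < \sum_(1 <= k < n.+1) (a * X k%:Z w i ord0 - b)]).
Proof.
move=> stat erg intX ab.
pose f (x : pathT) : R := a * x 0 i ord0 - b.
have mf : measurable_fun setT f.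
  apply: measurable_funB => //; apply: measurable_funM => //.
  exact: measurable_coordinate.
have intaX : P.-integrable setT (fun w => (a * X 0 w i ord0)%:E).
  exact: (integrableZl measurableT a intX).
have intfX : P.-integrable setT (EFin \o (f \o path)).
  exact: (integrableB measurableT intaX
    (finite_measure_integrable_cst P b measurableT)).
have intf : (distribution P path).-integrable setT (EFin \o f).
  apply: integrable_pushforward => //; exact/measurable_EFinP.
have f_lt0 : (\int[distribution P path]_x (f x)%:E < 0)%E.
  rewrite integral_distribution //; last exact/measurable_EFinP.
  rewrite /= (integralB_EFin measurableT intaX
    (finite_measure_integrable_cst P b measurableT)).
  rewrite (integralZl measurableT intX).
  move: ab; rewrite /mean_vec mxE unlock => ab.
  rewrite -(fineK (integrable_fin_num measurableT intX)).
  have -> : (\int[P]_w b%:E = b%:E)%E.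
    have := integral_cst P measurableT b%:E.
    by rewrite /= probability_setT mule1.
  rewrite -EFinM -EFinB lte_fin.
  by rewrite subr_lt0.
have [B [mB EB PB]] := @birkhoff_sum_tail _ _ _ (distribution P path) _
  (measurable_shift_path 1) (stat 1) erg f intf f_lt0.
(* The event is pulled back along the shifted path, which realises the change
   of time origin without affecting probabilities. *)
exists (fun N => [set w | B N (shift_path 1 (X ^~ w))]); split.
- move=> N; rewrite -[X in measurable X]setTI.
  have mc := measurableT_comp (measurable_shift_path 1) mpath.
  exact: (mc measurableT _ (mB N)).
- apply: filterS EB => N EB w [n Nn]; apply: EB; exists n.
  rewrite (lt_le_trans Nn) // big_add1 /= big_mkord.
  apply: ler_sum => k _; rewrite /f iter_shift_path /shift_path add0r.
  by rewrite -PoszD addn1.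
- by rewrite (_ : (fun N => _) = distribution P path \o B) //;
    apply/funext => N; exact: (stat 1 (B N) (mB N)).
Qed.

End path_law.

Section law_of_large_numbers.
Context {disp : measure_display} {T : measurableType disp} {R : realType}.
Context {d : nat}.
Variables (P : probability T R) (X : int -> T -> 'cV[R]_d).
Hypothesis X_rv : forall t, random_mx (X t).
Hypothesis X_L2 : ('E_P[fun w => (enorm (X 0 w) ^+ 2)%R] < +oo)%E.

Lemma integrable_coordinate (i : 'I_d) :
  P.-integrable setT (fun w => (X 0 w i ord0)%:E).
Proof.
pose g w : R := enorm (X 0 w) ^+ 2.
have gE w : g w = \sum_(i < d) X 0 w i ord0 ^+ 2.
  by rewrite /g /enorm sqr_sqrtr // sumr_ge0 // => j _; exact: sqr_ge0.
have mg : measurable_fun setT g.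
  rewrite (funext gE).
  by apply: measurable_sum => j; apply: measurable_funX; exact: X_rv.
have intg : P.-integrable setT (EFin \o g).
  apply/integrableP; split; first exact/measurable_EFinP.
  move: X_L2; rewrite unlock; apply: le_lt_trans.
  by under eq_integral do rewrite /= ger0_norm ?sqr_ge0 //.
have int1g : P.-integrable setT (EFin \o (fun w => 1 + g w)).
  exact: (integrableD measurableT
    (finite_measure_integrable_cst P 1 measurableT) intg).
apply: le_integrable int1g => //; first exact/measurable_EFinP/X_rv.
move=> w _; rewrite /= lee_fin [leRHS]ger0_norm ?addr_ge0 ?sqr_ge0 //.
have : X 0 w i ord0 ^+ 2 <= g w.
  rewrite gE (bigD1 i) //= lerDl sumr_ge0 // => j _; exact: sqr_ge0.
by rewrite ler_norml; nra.
Qed.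

(** Each coordinate is recentred, with either sign, and rescaled by [2 / delta],
so that the tail bound reads: the deviation at time [n] is at most
[(N + n) * delta / 2], for all [n] at once.  For [n <= N] this is at most
[delta * N]. *)
Lemma uniform_weak_lln (delta : R) :
  strictly_stationary P X -> ergodic P X -> 0 < delta ->
  asymp_negligible P (fun N => [set w | exists2 n, (n <= N)%N &
    delta * N%:R <
    `|\sum_(1 <= k < n.+1) X k%:Z w - n%:R *: mean_vec P (X 0)|]).
Proof.
move=> stat erg delta0; set m := mean_vec P (X 0).
pose c : R := 2 / delta.
have c0 : 0 < c by rewrite divr_gt0.
have below1 (s : R) (i : 'I_d) : s * m i ord0 < s * m i ord0 + 1.
  by rewrite ltrDl.
have negE (i : 'I_d) := asymp_negligibleU
  (stationary_sum_tail X_rv stat erg (integrable_coordinate i) (below1 c i))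
  (stationary_sum_tail X_rv stat erg (integrable_coordinate i) (below1 (- c) i)).
apply: asymp_negligible_sub (asymp_negligible_bigcup negE).
apply: nearW => N w [n nN] /mx_norm_gt[|[i j] /=].
  by rewrite mulr_ge0 // ltW.
rewrite (ord1 j) => H; exists i.
have entryE (v : 'cV[R]_d) : (\sum_(1 <= k < n.+1) X k%:Z w - n%:R *: v) i ord0
    = \sum_(1 <= k < n.+1) X k%:Z w i ord0 - n%:R * v i ord0.
  by rewrite !mxE summxE.
rewrite entryE in H.
have E (s : R) : \sum_(1 <= k < n.+1)
    (s * X k%:Z w i ord0 - (s * m i ord0 + 1)) =
    s * (\sum_(1 <= k < n.+1) X k%:Z w i ord0 - n%:R * m i ord0) - n%:R.
  rewrite sumrB -mulr_sumr sumr_const_nat subSS subn0 -[_ *+ n]mulr_natl.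
  by ring.
have nNR : n%:R <= N%:R :> R by rewrite ler_nat.
have H2 : N%:R + N%:R <
    c * `|\sum_(1 <= k < n.+1) X k%:Z w i ord0 - n%:R * m i ord0|.
  rewrite /c mulrAC ltr_pdivlMr //; move: H; lra.
move: H2; case: (ger0P (\sum_(1 <= k < n.+1) X k%:Z w i ord0 - n%:R * m i ord0)).
  by move=> _ H2; left; exists n; rewrite E; lra.
by move=> _ H2; right; exists n; rewrite E; lra.
Qed.

End law_of_large_numbers.

(** * Stability of quadratic forms and of matrix inverses *)

Section quadratic_forms.
Context {R : realType} {d : nat}.
Implicit Types (A Q S : 'M[R]_d) (x y v : 'cV[R]_d).

Let bil A x y : R := (x^T *m A *m y) ord0 ord0.

Let bil_le A x y : `|bil A x y| <= d%:R ^+ 2 * (`|A| * `|x| * `|y|).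
Proof.
apply: le_trans (mx_norm_entry _ _ _) _.
apply: le_trans (mx_norm_mul _ _) _.
have xT : `|x^T| <= `|x|.
  by apply: mx_norm_le => // i j; rewrite mxE mx_norm_entry.
have := le_trans (mx_norm_mul x^T A)
  (ler_wpM2r (normr_ge0 A) (ler_wpM2l (ler0n R d) xT)).
move=> /(ler_wpM2l (ler0n R d)) /(ler_wpM2r (normr_ge0 y)) /le_trans; apply.
by rewrite le_eqVlt; apply/orP; left; apply/eqP; ring.
Qed.

Let bilBl A x y z : bil A (x - y) z = bil A x z - bil A y z.
Proof.
rewrite /bil [(x - y)^T]linearB /= !mulmxBl [LHS]mxE.
by rewrite [X in _ + X]mxE.
Qed.

Let bilBr A x y z : bil A x (y - z) = bil A x y - bil A x z.
Proof. by rewrite /bil mulmxBr [LHS]mxE [X in _ + X]mxE. Qed.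

Let bilBm A Q x y : bil (A - Q) x y = bil A x y - bil Q x y.
Proof.
by rewrite /bil mulmxBr mulmxBl [LHS]mxE [X in _ + X]mxE.
Qed.

Let bilZl A (c : R) x y : bil A (c *: x) y = c * bil A x y.
Proof.
by rewrite /bil [(c *: x)^T]linearZ /= -!scalemxAl [LHS]mxE.
Qed.

Let bilZr A (c : R) x y : bil A x (c *: y) = c * bil A x y.
Proof. by rewrite /bil -scalemxAr [LHS]mxE. Qed.

Lemma quadformZ A (c : R) x : quadform A (c *: x) = c ^+ 2 * quadform A x.
Proof.
by rewrite -[LHS]/(bil A (c *: x) (c *: x)) bilZl bilZr mulrA.
Qed.

Lemma enorm_sqr x : enorm x ^+ 2 = quadform 1%:M x.
Proof.
rewrite /enorm sqr_sqrtr; last by apply: sumr_ge0 => i _; exact: sqr_ge0.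
rewrite /quadform mulmx1 mxE; apply: eq_bigr => i _.
by rewrite mxE expr2.
Qed.

Lemma posdefmx1 : posdefmx (1%:M : 'M[R]_d).
Proof.
split=> [|x x0]; first exact: trmx1.
have E : quadform 1%:M x = \sum_(i < d) x i ord0 ^+ 2.
  rewrite -enorm_sqr sqr_sqrtr // sumr_ge0 // => i _; exact: sqr_ge0.
rewrite lt_neqAle E sumr_ge0 ?andbT; last by move=> i _; exact: sqr_ge0.
apply: contra x0; rewrite eq_sym psumr_eq0; last by move=> i _; exact: sqr_ge0.
move=> /allP x0; apply/eqP/colP => i; rewrite mxE.
by have := x0 i (mem_index_enum i); rewrite /= sqrf_eq0 => /eqP.
Qed.

(** A kernel vector of [S] would have a vanishing quadratic form. *)
Lemma posdefmx_unit S : posdefmx S -> S \in unitmx.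
Proof.
move=> [symS posS]; rewrite -row_free_unit -kermx_eq0.
apply: contraT => /matrix0Pn[i [j kij]].
pose v : 'cV[R]_d := (row i (kermx S))^T.
have v0 : v != 0.
  apply: contraNneq kij => v0; have : v j ord0 = 0 by rewrite v0 mxE.
  by rewrite !mxE => ->.
have := posS v v0; rewrite /quadform trmxK -row_mul mulmx_ker.
by rewrite row0 mul0mx mxE ltxx.
Qed.

(** The form of the inverse at [v] is the form of [S] at [invmx S *m v], by
symmetry. *)
Lemma quadform_invmx_gt0 S v :
  posdefmx S -> v != 0 -> 0 < quadform (invmx S) v.
Proof.
move=> pdS v0; have uS := posdefmx_unit pdS; case: pdS => symS posS.
have -> : quadform (invmx S) v = quadform S (invmx S *m v).
  rewrite /quadform trmx_mul trmx_inv symS.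
  by rewrite -!mulmxA (mulmxA S) mulmxV // mul1mx.
apply: posS; apply: contraNneq v0 => /(congr1 (mulmx S)).
by rewrite mulmxA mulmxV // mul1mx mulmx0 => ->.
Qed.

(** The constant is explicit so that it can be fixed before [eta] is chosen;
[eta <= 1] absorbs the quadratic remainders into linear ones. *)
Lemma quadform_perturb A Q r v (h eta : R) :
  0 <= h <= 1 -> eta <= 1 -> `|A - Q| <= eta -> `|r| <= eta ->
  `|quadform A (r - h *: v) - h ^+ 2 * quadform Q v| <=
  (d%:R ^+ 2 * (`|v| ^+ 2 + (`|Q| + 1) * (2 * `|v| + 1))) * eta.
Proof.
move=> /andP[h0 h1] eta1 AQ rle.
have eta0 : 0 <= eta by exact: le_trans (normr_ge0 r) rle.
have -> : quadform A (r - h *: v) - h ^+ 2 * quadform Q v =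
    h ^+ 2 * bil (A - Q) v v - h * bil A v r - h * bil A r v + bil A r r.
  rewrite -[quadform A _]/(bil A _ _) -[quadform Q v]/(bil Q v v).
  by rewrite bilBm !bilBl !bilBr !bilZl !bilZr; ring.
have Ale : `|A| <= `|Q| + 1.
  rewrite -(subrK Q A) addrC (le_trans (ler_normD _ _)) // lerD2l.
  exact: le_trans AQ eta1.
have D0 : 0 <= d%:R ^+ 2 :> R by exact: sqr_ge0.
have b1 : `|h ^+ 2 * bil (A - Q) v v| <= d%:R ^+ 2 * `|v| ^+ 2 * eta.
  rewrite normrM [`|_ ^+ 2|]ger0_norm ?exprn_ge0 //.
  rewrite -[leRHS]mul1r ler_pM ?exprn_ge0 ?expr_le1 //.
  rewrite (le_trans (bil_le _ _ _)) // -[leRHS]mulrA ler_wpM2l //.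
  by rewrite -mulrA mulrC -expr2 ler_wpM2l ?exprn_ge0.
have bil_eta x y (c : R) : `|x| * `|y| <= c ->
    `|bil A x y| <= d%:R ^+ 2 * ((`|Q| + 1) * c).
  move=> xyc; rewrite (le_trans (bil_le _ _ _)) // ler_wpM2l // -mulrA.
  by rewrite ler_pM // mulr_ge0.
have b2 : `|h * bil A v r| <= d%:R ^+ 2 * ((`|Q| + 1) * (`|v| * eta)).
  rewrite normrM ger0_norm // -[leRHS]mul1r ler_pM //.
  by apply: bil_eta; rewrite ler_wpM2l.
have b3 : `|h * bil A r v| <= d%:R ^+ 2 * ((`|Q| + 1) * (`|v| * eta)).
  rewrite normrM ger0_norm // -[leRHS]mul1r ler_pM //.
  by apply: bil_eta; rewrite mulrC ler_wpM2l.
have b4 : `|bil A r r| <= d%:R ^+ 2 * ((`|Q| + 1) * eta).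
  by apply: bil_eta; rewrite -[leRHS]mulr1 ler_pM // (le_trans rle).
rewrite (le_trans (ler_normD _ _)) //.
rewrite (le_trans (lerD (ler_normB _ _) b4)) //.
rewrite (le_trans (lerD (lerD (ler_normB _ _) b3) (lexx _))) //.
rewrite (le_trans (lerD (lerD (lerD b1 b2) (lexx _)) (lexx _))) //.
by rewrite le_eqVlt; apply/orP; left; apply/eqP; ring.
Qed.

(** Both conclusions come from multiplying by [A - S] and [invmx S], which for
small [A - S] shrinks the norm by a factor at least 2: a row killed by [A] is
fixed up to sign by this operation, hence zero; and
[invmx A - invmx S = - (invmx A *m (A - S) *m invmx S)]. *)
Lemma invmx_perturb S (eta : R) : S \in unitmx -> 0 < eta ->
  exists2 theta : R, 0 < theta & forall A, `|A - S| <= theta ->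
    A \in unitmx /\ `|invmx A - invmx S| <= eta.
Proof.
move=> uS eta0; pose Q := invmx S; pose c : R := d%:R ^+ 2 * `|Q| + 1.
have dQ0 : 0 <= d%:R ^+ 2 * `|Q| by rewrite mulr_ge0 ?sqr_ge0.
have c0 : 0 < c by rewrite ltr_wpDl.
have Q0 : 0 < `|Q| + 1 by rewrite ltr_wpDl.
exists (Num.min (1 / (2 * c)) (eta / (2 * c * (`|Q| + 1)))).
  by rewrite lt_min !divr_gt0 ?mulr_gt0.
move=> A; rewrite le_min ler_pdivlMr ?mulr_gt0 // ler_pdivlMr ?mulr_gt0 //.
move=> /andP[AS1 AS2].
have mul3_le m (V : 'M[R]_(m, d)) :
    `|V *m (A - S) *m Q| <= d%:R ^+ 2 * `|Q| * `|A - S| * `|V|.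
  rewrite (le_trans (mx_norm_mul _ _)) //.
  rewrite (le_trans (ler_wpM2r _ (ler_wpM2l _ (mx_norm_mul _ _)))) //.
  by rewrite le_eqVlt; apply/orP; left; apply/eqP; ring.
have half : d%:R ^+ 2 * `|Q| * `|A - S| <= 2^-1.
  have := normr_ge0 (A - S); move: AS1; rewrite /c; nra.
have uA : A \in unitmx.
  rewrite -row_free_unit -kermx_eq0 -normr_eq0.
  have kE : kermx A = - (kermx A *m (A - S) *m Q).
    by rewrite mulmxBr mulmx_ker sub0r mulNmx opprK -mulmxA mulmxV // mulmx1.
  have := mul3_le _ (kermx A); rewrite -normrN -kE.
  have k0 := normr_ge0 (kermx A); move: half.
  set s := d%:R ^+ 2 * _ * _ => half kle.
  by apply/eqP/le_anti; rewrite k0 andbT; nra.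
split => //.
have dE : invmx A - Q = - (invmx A *m (A - S) *m Q).
  rewrite mulmxBr mulVmx // mulmxBl mul1mx -mulmxA mulmxV // mulmx1.
  by rewrite opprB.
have := mul3_le _ (invmx A); rewrite -normrN -dE -/Q.
have Ai : `|invmx A| <= `|invmx A - Q| + `|Q|.
  by rewrite -{1}(subrK Q (invmx A)) ler_normD.
have AS0 := normr_ge0 (A - S).
have s2 : d%:R ^+ 2 * `|Q| * `|A - S| * (2 * `|Q|) <= eta.
  apply: le_trans AS2.
  have -> : `|A - S| * (2 * c * (`|Q| + 1)) =
     d%:R ^+ 2 * `|Q| * `|A - S| * (2 * `|Q|)
     + 2 * `|A - S| * (d%:R ^+ 2 * `|Q| + (`|Q| + 1)) by rewrite /c; ring.
  by rewrite lerDl mulr_ge0 ?mulr_ge0 // addr_ge0 // ltW.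
have s0 : 0 <= d%:R ^+ 2 * `|Q| * `|A - S| by rewrite mulr_ge0.
move: half s0 s2 Ai; set s := d%:R ^+ 2 * _ * _.
have := normr_ge0 (invmx A - Q); have := normr_ge0 Q.
set a := `|_ - Q|; set b := `|invmx A|; set q := `|Q|.
move=> q0 a0 half s0 s2 bq ab.
have : s * b <= s * (a + q) by rewrite ler_wpM2l.
have : s * a <= 2^-1 * a by rewrite ler_wpM2r.
by nra.
Qed.

End quadratic_forms.

(** * Maximisers of functions close to a tent *)

Section argmax.
Context {R : realType}.
Implicit Types (F : R -> R) (k c b tau : R).

(** The separation hypothesis says that [F] falls below [F k] linearly in the
distance to [k], up to [b].  When the supremum is only attained as a left limit,
the inequality passes to the limit along [s --> tau^'-]. *)
Lemma argmax01_near F k c b tau : 0 <= k <= 1 ->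
  (forall s, 0 <= s <= 1 -> c * `|s - k| <= F k - F s + b) ->
  argmax01 F tau -> c * `|tau - k| <= b.
Proof.
move=> k01 sep [tau01 top].
have Fk : (F @` `[0, 1]) (F k) by exists k => //=; rewrite in_itv.
case: top => [[/(_ _ Fk) Fktau _]|[tau0 [l [Fl [/(_ _ Fk) Fkl _]]]]].
  by have := sep tau tau01; lra.
suff : c * `|tau - k| <= F k - l + b by lra.
have cvgL : c * `|s - k| @[s --> tau^'-] --> c * `|tau - k|.
  apply: cvgM; first exact: cvg_cst.
  apply: cvg_norm; apply: cvgB; last exact: cvg_cst.
  exact: cvg_at_left_filter cvg_id.
have cvgR : F k - F s + b @[s --> tau^'-] --> F k - l + b.
  apply: cvgD; last exact: cvg_cst.
  by apply: cvgB => //; exact: cvg_cst.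
apply: (ler_cvg_to cvgL cvgR); near=> s; apply: sep.
apply/andP; split; first by near: s; exact: nbhs_left_ge.
case/andP: tau01 => _; apply: le_trans.
near: s; exact: nbhs_left_le.
Unshelve. all: by end_near. Qed.

(** Squaring turns the maximisation of a norm into that of a quadratic form. *)
Lemma argmax01_sqr F c tau : 0 < c -> (forall s, 0 <= F s) ->
  argmax01 F tau -> argmax01 (fun s => c * F s ^+ 2) tau.
Proof.
move=> c0 F0 [tau01 top]; split => //.
have sqr_top (l : R) : supremums (F @` `[0, 1]) l ->
    supremums ((fun s => c * F s ^+ 2) @` `[0, 1]) (c * l ^+ 2).
  move=> [ubl lel].
  have F0l : F 0 <= l by apply: ubl; exists 0 => //=; rewrite in_itv /= lexx ler01.
  have l0 : 0 <= l by exact: le_trans F0l.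
  split=> [_ [s s01 <-]|u ubu].
    by rewrite ler_pM2l // ler_sqr ?nnegrE // ubl //; exists s.
  have cFu s : `[0, 1]%classic s -> c * F s ^+ 2 <= u.
    by move=> s01; apply: ubu; exists s.
  have u0 : 0 <= u.
    apply: (le_trans _ (cFu 0 _)); first by rewrite mulr_ge0 ?sqr_ge0 // ltW.
    by rewrite /= in_itv /= lexx ler01.
  have uc0 : 0 <= u / c by rewrite divr_ge0 // ltW.
  rewrite mulrC -ler_pdivlMr // -[leRHS]sqr_sqrtr // ler_sqr ?nnegrE ?sqrtr_ge0 //.
  apply: lel => _ [s s01 <-].
  rewrite -ler_sqr ?nnegrE ?sqrtr_ge0 // sqr_sqrtr // ler_pdivlMr // mulrC.
  exact: cFu.
case: top => [top|[tau0 [l [Fl top]]]]; [left; exact: sqr_top|right].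
split => //; exists (c * l ^+ 2); split; last exact: sqr_top.
by apply: cvgM; [exact: cvg_cst|rewrite expr2; apply: cvgM].
Qed.

End argmax.

Section tent.
Context {R : realType}.
Implicit Types k s t : R.

(** The piecewise linear function equal to [t * (1 - k)] before [k] and to
[k * (1 - t)] after it; the present form keeps the two regimes together. *)
Definition tent k t : R := Num.min t k - t * k.

Lemma tent01 k t : 0 <= k <= 1 -> 0 <= t <= 1 -> 0 <= tent k t <= 1.
Proof.
move=> /andP[k0 k1] /andP[t0 t1]; rewrite /tent.
have tk0 := mulr_ge0 t0 k0.
have : 0 <= t * (1 - k) by rewrite mulr_ge0 ?subr_ge0.
have : 0 <= k * (1 - t) by rewrite mulr_ge0 ?subr_ge0.
by case: (leP t k) => tk; lra.
Qed.

(** The slopes of the tent are [1 - k] and [- k]; both are at least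
[k * (1 - k)] in absolute value, and the factor [tent k k + tent k s] of the
difference of squares is at least the peak value [k * (1 - k)]. *)
Lemma tent_peak k s : 0 <= k <= 1 -> 0 <= s <= 1 ->
  (k * (1 - k)) ^+ 2 * `|s - k| <= tent k k ^+ 2 - tent k s ^+ 2.
Proof.
move=> k01 s01.
have gap : k * (1 - k) * `|s - k| <= tent k k - tent k s.
  move: k01 s01 => /andP[k0 k1] /andP[s0 s1]; rewrite /tent minxx.
  case: (leP s k) => sk.
    rewrite distrC ger0_norm ?subr_ge0 //.
    have : 0 <= (1 - k) * ((1 - k) * (k - s)) by rewrite !mulr_ge0 ?subr_ge0.
    lra.
  rewrite ger0_norm; last by rewrite subr_ge0 ltW.
  have : 0 <= k * (k * (s - k)) by rewrite !mulr_ge0 // subr_ge0 ltW.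
  lra.
have tk : tent k k = k * (1 - k) by rewrite /tent minxx; ring.
have /andP[ts0 _] := tent01 k01 s01.
have /andP[tk0 _] := tent01 k01 k01.
rewrite -tk in gap *; have := normr_ge0 (s - k).
have : tent k k * (tent k k * `|s - k|) <= tent k k * (tent k k - tent k s).
  by rewrite ler_wpM2l.
have : 0 <= tent k s * (tent k k - tent k s).
  by rewrite mulr_ge0 // (le_trans _ gap) // mulr_ge0.
nra.
Qed.

Lemma argmax01_tent (F : R -> R) k q e tau : 0 <= k <= 1 -> 0 <= q ->
  (forall t, 0 <= t <= 1 -> `|F t - tent k t ^+ 2 * q| <= e) ->
  argmax01 F tau -> q * (k * (1 - k)) ^+ 2 * `|tau - k| <= 2 * e.
Proof.
move=> k01 q0 Fe; apply: argmax01_near => // s s01.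
have := Fe s s01; have := Fe k k01; rewrite !ler_distl.
move=> /andP[k1 k2] /andP[s1 s2].
have := ler_wpM2l q0 (tent_peak k01 s01); lra.
Qed.

End tent.

(** * The CUSUM process against the tent *)

Section cusum_decomposition.
Context {disp : measure_display} {T : measurableType disp} {R : realType}.
Context {d : nat}.
Variables (X Xs : int -> T -> 'cV[R]_d) (w : T) (v : 'cV[R]_d).
Variables (N : nat) (k delta : R).
Hypotheses (N_gt0 : (0 < N)%N) (k01 : 0 <= k <= 1).
Hypothesis X_small : forall n, (n <= N)%N ->
  `|\sum_(1 <= i < n.+1) X i%:Z w| <= delta * N%:R.
Hypothesis Xs_small : forall n, (n <= N)%N ->
  `|\sum_(1 <= i < n.+1) Xs i%:Z w - n%:R *: v| <= delta * N%:R.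

Let Tstar := Num.truncn (k * N%:R).
Let Y := change_at Tstar X Xs.

Let truncn_leN (x : R) : x <= N%:R -> (Num.truncn x <= N)%N.
Proof.
move=> xN; have [x0|x0] := leP 0 x; last first.
  have -> : Num.truncn x = 0%N by apply/truncn0Pn; rewrite -ltNge; lra.
  by [].
by rewrite -(ler_nat R) (le_trans _ xN) // truncn_le.
Qed.

(* After the change, the sum of the [Xs] from [Tstar] on is a difference of two
   partial sums from 1, the only sums controlled by the law of large numbers. *)
Let sum_change (n : nat) : \sum_(1 <= i < n.+1) Y i%:Z w =
  \sum_(1 <= i < (minn n Tstar).+1) X i%:Z w +
  (\sum_(1 <= i < n.+1) Xs i%:Z w -
   \sum_(1 <= i < (minn n Tstar).+1) Xs i%:Z w).
Proof.
have before m : (m <= Tstar)%N ->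
    \sum_(1 <= i < m.+1) Y i%:Z w = \sum_(1 <= i < m.+1) X i%:Z w.
  move=> mT; apply: eq_big_nat => i /andP[_ im].
  by rewrite /Y /change_at lez_nat (leq_trans _ mT).
have [nT|Tn] := leqP n Tstar; first by rewrite subrr addr0 before.
rewrite (@big_cat_nat _ _ _ Tstar.+1) //=; last exact: ltnW.
rewrite before //; congr (_ + _).
rewrite [in RHS](@big_cat_nat _ _ _ Tstar.+1) //=; last exact: ltnW.
rewrite addrAC subrr add0r; apply: eq_big_nat => i /andP[Ti _].
by rewrite /Y /change_at lez_nat leqNgt Ti.
Qed.

Let partial_sum_close (n : nat) : (n <= N)%N ->
  `|\sum_(1 <= i < n.+1) Y i%:Z w - (n%:R - (minn n Tstar)%:R) *: v| <=
  3 * (delta * N%:R).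
Proof.
move=> nN; have mN : (minn n Tstar <= N)%N by rewrite (leq_trans (geq_minl _ _)).
rewrite sum_change scalerBl.
set x := \sum_(1 <= i < _) X _ _; set a := \sum_(1 <= i < n.+1) _.
set b := \sum_(1 <= i < _) _.
have -> : x + (a - b) - (n%:R *: v - (minn n Tstar)%:R *: v) =
    x + (a - n%:R *: v) - (b - (minn n Tstar)%:R *: v).
  rewrite !opprB -!addrA; congr (_ + (_ + _)).
  by rewrite addrCA [RHS]addrCA; congr (_ + _); rewrite addrC.
have := ler_normB (x + (a - n%:R *: v)) (b - (minn n Tstar)%:R *: v).
have := ler_normD x (a - n%:R *: v).
have := X_small mN; have := Xs_small nN; have := Xs_small mN.
rewrite -/x -/a -/b; lra.
Qed.

(** The mean of the unscaled CUSUM at [t] is a multiple of [v]; replacing in it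
the integer parts of [N * t] and of [k * N] by these numbers yields
[- N * tent k t] at the cost of at most three rounding errors. *)
Lemma cusum_tent (t : R) : 0 <= t <= 1 ->
  exists2 r : 'cV[R]_d, `|r| <= 6 * delta + 3 * `|v| / N%:R &
  cusum Y N w t = Num.sqrt N%:R *: (r - tent k t *: v).
Proof.
move=> /andP[t0 t1]; case/andP: (k01) => k0 k1.
have N0 : 0 < N%:R :> R by rewrite ltr0n.
set n := Num.truncn (N%:R * t).
have nN : (n <= N)%N by rewrite truncn_leN // ler_piMr // ltW.
have TN : (Tstar <= N)%N by rewrite truncn_leN // ler_piMl // ltW.
have /andP[n1 n2] : n%:R <= N%:R * t < n.+1%:R by rewrite truncn_itv ?mulr_ge0.
have /andP[T1 T2] : Tstar%:R <= k * N%:R < Tstar.+1%:R.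
  by rewrite truncn_itv ?mulr_ge0.
rewrite -natr1 in n2; rewrite -natr1 in T2.
pose en := \sum_(1 <= i < n.+1) Y i%:Z w - (n%:R - (minn n Tstar)%:R) *: v.
pose eN := \sum_(1 <= i < N.+1) Y i%:Z w - (N%:R - Tstar%:R) *: v.
have enle : `|en| <= 3 * (delta * N%:R) by exact: partial_sum_close.
have eNle : `|eN| <= 3 * (delta * N%:R).
  by have := partial_sum_close (leqnn N); rewrite (minn_idPr TN).
(* Distance from the multiple of [v] to its value without rounding. *)
pose g : R := n%:R - (minn n Tstar)%:R - t * (N%:R - Tstar%:R)
  + N%:R * tent k t.
have gle : `|g| <= 3.
  have -> : g = (n%:R - N%:R * t)
      - ((minn n Tstar)%:R - Num.min (N%:R * t) (k * N%:R))
      + t * (Tstar%:R - k * N%:R).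
    have -> : Num.min (N%:R * t) (k * N%:R) = N%:R * Num.min t k.
      by rewrite minr_pMr ?ltW // [k * _]mulrC.
    by rewrite /g /tent; ring.
  have m1 : `|(minn n Tstar)%:R - Num.min (N%:R * t) (k * N%:R)| <= 1.
    by case: leqP => nT; case: (leP (N%:R * t) _) => tk; rewrite ler_norml;
      move: nT; rewrite -?(ler_nat R) -?(ltr_nat R) => nT; lra.
  move: m1; rewrite !ler_norml; set m := _ - Num.min _ _ => /andP[m1 m2].
  have : t * (k * N%:R - Tstar%:R) <= 1 * 1 by rewrite ler_pM ?subr_ge0 //; lra.
  have : 0 <= t * (k * N%:R - Tstar%:R) by rewrite mulr_ge0 ?subr_ge0.
  lra.
exists (N%:R^-1 *: (en - t *: eN + g *: v)).
  rewrite normrZ ger0_norm ?invr_ge0 ?(ltW N0) // ler_pdivrMl // [leRHS]mulrC.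
  have -> : (6 * delta + 3 * `|v| / N%:R) * N%:R =
      6 * (delta * N%:R) + 3 * `|v| by field; rewrite gt_eqF.
  have := ler_normD (en - t *: eN) (g *: v); have := ler_normB en (t *: eN).
  rewrite !normrZ (ger0_norm t0).
  have : t * `|eN| <= 1 * `|eN| by rewrite ler_wpM2r.
  have : `|g| * `|v| <= 3 * `|v| by rewrite ler_wpM2r.
  lra.
have sq : (Num.sqrt N%:R)^-1 = Num.sqrt N%:R * N%:R^-1 :> R.
  have s0 : Num.sqrt N%:R != 0 :> R by rewrite gt_eqF ?sqrtr_gt0.
  by rewrite -{3}(sqr_sqrtr (ltW N0)) expr2 invfM mulrA divff // mul1r.
rewrite /cusum -/n sq -scalerA; congr (_ *: _).
have -> : tent k t *: v = N%:R^-1 *: ((N%:R * tent k t) *: v).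
  by rewrite scalerA mulKf // gt_eqF.
rewrite -scalerBr; congr (_ *: _).
rewrite /en /eN /g.
apply/colP => i; rewrite !mxE; ring.
Qed.

End cusum_decomposition.

(** * Consistency *)

Section consistency.
Context {disp : measure_display} {T : measurableType disp} {R : realType}.
Context {d : nat}.
Variables (P : probability T R) (k : R) (X Xs : int -> T -> 'cV[R]_d).
Hypotheses (k01 : 0 < k < 1).
Hypotheses (X_rv : forall t, random_mx (X t)) (Xs_rv : forall t, random_mx (Xs t)).
Hypotheses (X_stat : strictly_stationary P X) (Xs_stat : strictly_stationary P Xs).
Hypotheses (X_erg : ergodic P X) (Xs_erg : ergodic P Xs).
Hypothesis X_mean0 : mean_vec P (X 0) = 0.
Hypothesis X_L2 : ('E_P[fun w => (enorm (X 0 w) ^+ 2)%R] < +oo)%E.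
Hypothesis Xs_L2 : ('E_P[fun w => (enorm (Xs 0 w) ^+ 2)%R] < +oo)%E.

Let v := mean_vec P (Xs 0).
Let S (N : nat) : T -> R -> 'cV[R]_d :=
  cusum (change_at (Num.truncn (k * N%:R)) X Xs) N.

(** On the event that [A N] is within [eta] of [Q] and that the partial sums of
[X] and [Xs] deviate by at most [eta / 12 * N], for large [N] the objective is
within [K * eta] of [tent k t ^+ 2 * quadform Q v] for all [t]; [eta] is chosen
so that this forces the maximiser to within [eps] of [k].  The maximising property is assumed
outside negligible events because [invmx (Sigmahat N w)] is the inverse only
where [Sigmahat N w] is invertible. *)
Lemma argmax_quadform_consistent (Q : 'M[R]_d) (A : nat -> T -> 'M[R]_d)
    (tau : nat -> {RV P >-> R}) :
  0 < quadform Q v ->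
  (forall eta : R, 0 < eta -> asymp_negligible P (fun N => [set w |
     ~ (`|A N w - Q| <= eta /\
        argmax01 (fun t => N%:R^-1 * quadform (A N w) (S N w t)) (tau N w))])) ->
  cvg_in_probability P tau k.
Proof.
move=> q0 Aneg eps eps0.
have k01w : 0 <= k <= 1 by rewrite !ltW //; case/andP: k01.
pose K : R := d%:R ^+ 2 * (`|v| ^+ 2 + (`|Q| + 1) * (2 * `|v| + 1)).
have K0 : 0 <= K.
  apply: mulr_ge0; first exact: sqr_ge0.
  apply: addr_ge0; first exact: sqr_ge0.
  by apply: mulr_ge0; apply: addr_ge0 => //; exact: mulr_ge0.
pose c : R := quadform Q v * (k * (1 - k)) ^+ 2.
have c0 : 0 < c.
  by case/andP: k01 => k0 k1; rewrite mulr_gt0 // exprn_gt0 // mulr_gt0 // subr_gt0.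
pose eta : R := Num.min 1 (c * eps / (2 * (K + 1))).
have K1 : 0 < 2 * (K + 1) by rewrite mulr_gt0 // ltr_wpDl.
have eta0 : 0 < eta by rewrite lt_min ltr01 divr_gt0 // mulr_gt0.
have eta1 : eta <= 1 by rewrite ge_min lexx.
have etaK : 2 * (K * eta) < c * eps.
  have : eta <= c * eps / (2 * (K + 1)) by rewrite ge_min lexx orbT.
  by rewrite ler_pdivlMr //; lra.
(* [cusum_tent] leaves a remainder [6 * delta + 3 * `|v| / N%:R]: half of [eta]
   for the fluctuations, half for the rounding. *)
pose delta : R := eta / 12.
have delta0 : 0 < delta by rewrite divr_gt0.
apply: asymp_negligible_cvg0.
  move=> N; rewrite -[X in measurable X]setTI.
  apply: (@measurable_fun_ltr _ _ _ setT (cst eps)) => //.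
  by apply: measurableT_comp => //; apply: measurable_funB.
have neg := asymp_negligibleU (Aneg eta eta0) (asymp_negligibleU
  (uniform_weak_lln X_rv X_L2 X_stat X_erg delta0)
  (uniform_weak_lln Xs_rv Xs_L2 Xs_stat Xs_erg delta0)).
apply: asymp_negligible_sub neg.
near=> N => w /= far; apply: contrapT => /not_orP[/contrapT[AQ amax]].
move=> /not_orP[Xdev Xsdev].
have N0 : (0 < N)%N by near: N; exact: nbhs_infty_gt.
have N0R : 0 < N%:R :> R by rewrite ltr0n.
have X_small n : (n <= N)%N -> `|\sum_(1 <= i < n.+1) X i%:Z w| <= delta * N%:R.
  move=> nN; rewrite leNgt; apply/negP => H; apply: Xdev; exists n => //.
  by rewrite X_mean0 scaler0 subr0.
have Xs_small n : (n <= N)%N ->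
    `|\sum_(1 <= i < n.+1) Xs i%:Z w - n%:R *: v| <= delta * N%:R.
  by move=> nN; rewrite leNgt; apply/negP => H; apply: Xsdev; exists n.
have vN : 3 * `|v| / N%:R <= eta / 2.
  rewrite ler_pdivrMr // -ler_pdivrMl ?divr_gt0 //.
  apply: (le_trans (ltW (truncnS_gt _))); rewrite ler_nat.
  near: N; exact: nbhs_infty_ge.
have close t : 0 <= t <= 1 ->
    `|N%:R^-1 * quadform (A N w) (S N w t) - tent k t ^+ 2 * quadform Q v|
    <= K * eta.
  move=> t01.
  rewrite /S; have [r rle ->] := cusum_tent N0 k01w X_small Xs_small t01.
  rewrite quadformZ sqr_sqrtr ?(ltW N0R) // mulKf ?(gt_eqF N0R) //.
  apply: quadform_perturb => //; first exact: tent01.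
  by move: rle; rewrite /delta; lra.
have := argmax01_tent k01w (ltW q0) close amax.
rewrite -/c => /le_lt_trans /(_ etaK); rewrite ltr_pM2l //.
by rewrite ltNge ltW.
Unshelve. all: by end_near. Qed.

End consistency.

Unset Implicit Arguments.

Theorem theorem3p2 (disp : measure_display) (T : measurableType disp)
  (R : realType) (P : probability T R) (d : nat) (kstar : R)
  (X Xs : int -> T -> 'cV[R]_d)
  (Sigma : 'M[R]_d) (Sigmahat : nat -> T -> 'M[R]_d)
  (kstar01 : 0 < kstar < 1)
  (X_rv : forall t, random_mx (X t))
  (X_stat : strictly_stationary P X) (X_erg : ergodic P X)
  (X_mean0 : mean_vec P (X 0) = 0)
  (X_L2 : ('E_P[fun w => (enorm (X 0 w) ^+ 2)%R] < +oo)%E)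
  (Xs_rv : forall t, random_mx (Xs t))
  (Xs_stat : strictly_stationary P Xs) (Xs_erg : ergodic P Xs)
  (Xs_mean : mean_vec P (Xs 0) <> mean_vec P (X 0))
  (Xs_L2 : ('E_P[fun w => (enorm (Xs 0 w) ^+ 2)%R] < +oo)%E)
  (Sigma_lrv : is_longrun_cov P X Sigma) (Sigma_posdef : posdefmx Sigma)
  (Sigmahat_rv : forall N, random_mx (Sigmahat N))
  (Sigmahat_cvg : cvg_in_probability P Sigmahat Sigma) :
  let S (N : nat) : T -> R -> 'cV[R]_d :=
    cusum (change_at (Num.truncn (kstar * N%:R)) X Xs) N in
  (forall tau : nat -> {RV P >-> R},
     (forall N w, (0 < N)%N -> argmax01 (fun t => enorm (S N w t)) (tau N w)) ->
     cvg_in_probability P tau kstar) /\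
  (forall tau : nat -> {RV P >-> R},
     (forall N w, (0 < N)%N -> 0 <= tau N w <= 1) ->
     (forall N w, (0 < N)%N -> Sigmahat N w \in unitmx ->
        argmax01 (fun t => N%:R^-1 * quadform (invmx (Sigmahat N w)) (S N w t))
          (tau N w)) ->
     cvg_in_probability P tau kstar).
Proof.
move=> S.
have v0 : mean_vec P (Xs 0) != 0 by apply/eqP; rewrite -X_mean0.
split=> [tau tau_max|tau _ tau_max].
(* The Euclidean norm is maximised where the form of the identity is. *)
- apply: (@argmax_quadform_consistent _ _ _ _ _ _ _ _ kstar01 X_rv Xs_rv
    X_stat Xs_stat X_erg Xs_erg X_mean0 X_L2 Xs_L2 1%:M (fun _ _ => 1%:M)).
    by have [_] := @posdefmx1 R d; apply.
  move=> eta eta0; apply: (@asymp_negligible_sub _ _ _ _ _ (fun=> set0)).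
    near=> N => w; apply; split; first by rewrite subrr normr0 ltW.
    have N0 : (0 < N)%N by near: N; exact: nbhs_infty_gt.
    have := @argmax01_sqr _ (fun t => enorm (S N w t)) N%:R^-1 (tau N w).
    rewrite invr_gt0 ltr0n => /(_ N0 (fun=> sqrtr_ge0 _) (tau_max N w N0)).
    by under [X in argmax01 X _]eq_fun do rewrite enorm_sqr.
  exists (fun=> set0); split => //; first by apply: nearW => N w.
  by under eq_fun do rewrite measure0; exact: cvg_cst.
- apply: (@argmax_quadform_consistent _ _ _ _ _ _ _ _ kstar01 X_rv Xs_rv
    X_stat Xs_stat X_erg Xs_erg X_mean0 X_L2 Xs_L2 (invmx Sigma)
    (fun N w => invmx (Sigmahat N w))).
    exact: quadform_invmx_gt0.
  move=> eta eta0.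
  have [theta theta0 inv_close] := invmx_perturb (posdefmx_unit Sigma_posdef) eta0.
  exists (fun N => [set w | theta < `|Sigmahat N w - Sigma|]); split.
  + by move=> N; exact: (measurable_mx_norm_gt _ (Sigmahat_rv N) (ltW theta0)).
  + near=> N => w /= bad; rewrite ltNge; apply/negP => /inv_close[uS close].
    have N0 : (0 < N)%N by near: N; exact: nbhs_infty_gt.
    by apply: bad; split => //; exact: tau_max.
  + exact: Sigmahat_cvg.
Unshelve. all: by end_near. Qed.
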